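(* Let $n\ge 2$ and let $K$ be a field with $\mathrm{char}(K)>n$ or $\mathrm{char}(K)=0$. If $A,B\in M_n(K)$ satisfy $$A^2-2AB+B^2=0,$$ then $A$ and $B$ are simultaneously triangularizable over the algebraic closure $\overline{K}$ of $K$.
   Context: Two matrices $A,B\in M_n(K)$ are simultaneously triangularizable over a field $L\supseteq K$ if there exists $P\in GL_n(L)$ such that $P^{-1}AP$ and $P^{-1}BP$ are both upper triangular. *)

(* Defs.v *)
From HB Require Import structures.
From mathcomp Require Import all_boot all_order all_algebra.

Set Implicit Arguments.
Unset Strict Implicit.
Unset Printing Implicit Defensive.

Import GRing.Theory.
Local Open Scope ring_scope.

(* [is_trig_mx] means lower triangular, hence the transpose. *)
Definition is_upper_trig_mx (R : nmodType) (n : nat) (M : 'M[R]_n) : bool :=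
  is_trig_mx M^T.

(* The inclusion of K in L is the ring morphism iota, which is injective
   because K is a field. *)
Definition sim_triangularizable_over (K L : fieldType) (iota : {rmorphism K -> L})
    (n : nat) (A B : 'M[K]_n) : Prop :=
  exists P : 'M[L]_n,
    [/\ P \in unitmx,
        is_upper_trig_mx (invmx P *m map_mx iota A *m P) &
        is_upper_trig_mx (invmx P *m map_mx iota B *m P)].

(* L, which is algebraically closed by its type, is an algebraic closure of K
   via iota. *)
Definition is_algebraic_closure (K : fieldType) (L : closedFieldType)
    (iota : {rmorphism K -> L}) : Prop :=
  forall x : L, algebraicOver iota x.

(* Main.v *)
Require Import Defs.
From HB Require Import structures.
From mathcomp Require Import all_boot all_order all_algebra.
Import GRing.Theory.
Local Open Scope ring_scope.

(** Put D = A - B. The relation A^2 - 2AB + B^2 = 0 says exactly that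
    DA - AD = D^2, so it suffices to triangularize together two matrices whose
    commutator is the square of one of them.

    The point is that D cannot be invertible: otherwise, multiplying by its
    inverse on both sides writes the identity as a commutator, and taking
    traces gives n = 0 in the field, which the characteristic excludes
    ([commutator_sqr_singular]). The kernel of D is therefore nonzero, and it
    is stable under A ([stablemx_kermx_commutator_sqr]). Over an algebraically
    closed field, A has an eigenvector in this kernel, which is a common
    eigenvector of A and D. The relation passes to the quotient by the line
    that it spans, and the smaller dimension still satisfies the condition on
    the characteristic, so induction on n concludes
    ([commutator_sqr_cotrig]).

    Matrices act on row vectors from the right, so a stable flag of rows yields
    lower triangular matrices. The induction is therefore run on X = A^T and
    N = D^T, for which the relation reads XN - NX = N^2. *)

Set Implicit Arguments.
Unset Strict Implicit.

(** If N had an inverse N', then N'(N^2)N' = N'(XN - NX)N' would give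
    1 = N'X - XN', a commutator, whose trace vanishes although tr 1 = n. *)
Lemma commutator_sqr_singular (F : fieldType) (n : nat) (X N : 'M[F]_n) :
  n%:R != 0 :> F -> X *m N - N *m X = N *m N -> N \notin unitmx.
Proof.
move=> n_neq0 XN; apply: contraNN n_neq0 => uN.
rewrite -(mxtrace1 F n).
have <- : invmx N *m (N *m N) *m invmx N = 1%:M by rewrite mulKmx // mulmxV.
by rewrite -XN mulmxBr mulmxBl mulKmx // -mulmxA mulmxK // raddfB /=
  mxtrace_mulC subrr.
Qed.

(** If uN = 0, then uXN = u(NX + N^2) = 0 as well. *)
Lemma stablemx_kermx_commutator_sqr (F : fieldType) (n : nat) (X N : 'M[F]_n) :
  X *m N - N *m X = N *m N -> stablemx (kermx N) X.
Proof.
move/eqP; rewrite subr_eq => /eqP XN; apply/sub_kermxP.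
by rewrite -mulmxA XN mulmxDr !mulmxA mulmx_ker !mul0mx addr0.
Qed.

(** An eigenvector of the restriction of X to V, in the coordinates given by
    the row base of V, maps to an eigenvector of X in V. *)
Lemma eigenvector_in_stablemx (F : closedFieldType) (m n : nat)
    (V : 'M[F]_(m, n)) (X : 'M[F]_n) :
  V != 0 -> stablemx V X ->
  exists2 v : 'rV_n, v != 0 & (v <= V)%MS /\ stablemx v X.
Proof.
move=> V_neq0 VX; have rV : (0 < \rank V)%N by rewrite lt0n mxrank_eq0.
have rfV := row_base_free V.
have [a /eigenvalueP[w wa w_neq0]] : exists a, eigenvalue (restrictmx V X) a.
  have [|a ra] := closed_rootP (char_poly (restrictmx V X)) _.
    by rewrite size_char_poly eqSS -lt0n.
  by exists a; rewrite eigenvalue_root_char.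
exists (w *m row_base V); first by rewrite mulmx_free_eq0.
split; first by rewrite -(eq_row_base V) submxMl.
have : (w <= eigenspace (restrictmx V X) a)%MS by apply/eigenspaceP.
rewrite sub_eigenspace_conjmx ?stablemx_row_base //.
by move/eigenspaceP=> ->; apply: scalemx_sub.
Qed.

(** The extended row base of v is a basis of the whole space whose first vector
    is proportional to v. In such a basis a matrix that stabilizes v is block
    triangular, and its lower right block is the map induced on the quotient
    by v. The base does not depend on X, so that two matrices sharing the
    eigenvector v are reduced simultaneously. *)
Lemma row_ebase_deflate (F : fieldType) (n : nat) (v : 'rV[F]_(1 + n))
    (X : 'M[F]_(1 + n)) :
  v != 0 -> stablemx v X ->
  exists a c Y, row_ebase v *m X = block_mx a 0 c Y *m row_ebase v.
Proof.
move=> v_neq0 /sub_rVP[a va]; set S := row_ebase v.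
have uS : S \in unitmx := row_ebase_unit v.
have rv : \rank v = 1%N by rewrite rank_rV v_neq0.
(* As v has rank 1, only the first row of S contributes to v. *)
have Ev : v = col_ebase v *m usubmx S.
  rewrite -{1}(mulmx_ebase v) rv -mulmxA -/S; congr (_ *m _).
  by rewrite -{1}(vsubmxK S) pid_mx_row mul_row_col mul1mx mul0mx addr0.
have Sa : usubmx S *m X = a *: usubmx S.
  apply: (can_inj (mulKmx (col_ebase_unit v))).
  by rewrite mulmxA -Ev -scalemxAr -Ev.
pose M := S *m X *m invmx S.
exists a%:M, (dlsubmx M), (drsubmx M).
suff -> : block_mx a%:M 0 (dlsubmx M) (drsubmx M) = M by rewrite mulmxKV.
have UM : usubmx M = row_mx a%:M 0.
  rewrite /M -!mul_usub_mx Sa -scalemxAl mul_usub_mx mulmxV // scalar_mx_block.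
  by rewrite block_mxEv col_mxKu scale_row_mx scaler0 scalemx1.
by rewrite -[RHS]submxK /ulsubmx /ursubmx UM row_mxKl row_mxKr.
Qed.

(** Induction on n, deflating a common eigenvector taken in the kernel of N.
    The condition on all 0 < k <= n keeps every successive quotient within
    reach of [commutator_sqr_singular]. The conclusion is phrased without
    inverses because the base changes then compose by mere associativity. *)
Lemma commutator_sqr_cotrig (F : closedFieldType) (n : nat) (X N : 'M[F]_n) :
  (forall k, (0 < k <= n)%N -> k%:R != 0 :> F) ->
  X *m N - N *m X = N *m N ->
  exists P T U : 'M[F]_n,
    [/\ P \in unitmx, is_trig_mx T /\ is_trig_mx U,
        P *m X = T *m P & P *m N = U *m P].
Proof.
elim: n X N => [|n IHn] X N charF XN.
  exists 1%:M, X, N; rewrite unitmx1 !mulmx1 !mul1mx.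
  by split=> //; split; apply/is_trig_mxP; case.
have [v v_neq0 [vN vX]] : exists2 v : 'rV_n.+1, v != 0 &
    (v <= kermx N)%MS /\ stablemx v X.
  apply: eigenvector_in_stablemx (stablemx_kermx_commutator_sqr XN).
  rewrite -mxrank_eq0 mxrank_ker subn_eq0 -ltnNge ltn_neqAle rank_leq_row andbT.
  rewrite -[_ == _]/(row_free N) row_free_unit.
  by rewrite (commutator_sqr_singular _ XN) // charF /=.
have [a [c [Y SX]]] := row_ebase_deflate v_neq0 vX.
have vN0 : stablemx v N.
  by move/sub_kermxP: vN => vN; rewrite vN sub0mx.
have [b [d [M SN]]] := row_ebase_deflate v_neq0 vN0.
have uS := row_ebase_unit v; set S : 'M_(1 + n) := row_ebase v in SX SN uS.
have YM : Y *m M - M *m Y = M *m M.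
  (* Read the relation, transported by S, on the lower right blocks. *)
  suff: block_mx a 0 c Y *m block_mx b 0 d M
      - block_mx b 0 d M *m block_mx a 0 c Y
      = block_mx b 0 d M *m block_mx b 0 d M.
    rewrite !mulmx_block opp_block_mx add_block_mx => /eq_block_mx[_ _ _].
    by rewrite !mulmx0 !add0r.
  apply: (can_inj (mulmxK uS)); rewrite mulmxBl -!mulmxA -SX -SN !mulmxA -SX -SN.
  by rewrite -!mulmxA -mulmxBr XN.
have [|P [T [U [uP [tT tU] PY PM]]]] := IHn Y M _ YM.
  by move=> k /andP[k0 kn]; rewrite charF // k0 ltnW.
pose Q : 'M_(1 + n) := block_mx 1%:M 0 0 P.
have uQ : Q \in unitmx by rewrite unitmxE det_ublock det1 mul1r -unitmxE.
exists (Q *m S), (block_mx a 0 (P *m c) T), (block_mx b 0 (P *m d) U).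
have trig_block (x : 'M[F]_1) y (V : 'M_n) :
    is_trig_mx V -> is_trig_mx (block_mx x 0 y V : 'M_(1 + n)).
  by move=> tV; rewrite is_trig_block_mx // eqxx mx11_is_trig.
have lift (Z V : 'M[F]_n) (W : 'M[F]_(1 + n)) x y : P *m Z = V *m P ->
    S *m W = block_mx x 0 y Z *m S ->
    Q *m S *m W = block_mx x 0 (P *m y) V *m (Q *m S).
  move=> PZ SW; rewrite -mulmxA SW !mulmxA !mulmx_block.
  by rewrite !(mul0mx, mulmx0, mul1mx, mulmx1, addr0, add0r) PZ.
split; first by rewrite unitmx_mul uQ.
- by split; apply: trig_block.
- exact: lift PY SX.
exact: lift PM SN.
Qed.

(** The form in which the hypothesis on the characteristic is inherited by
    smaller dimensions and by field extensions. *)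
Lemma natr_neq0_pchar (K : fieldType) (n : nat) :
  [pchar K] =i pred0 \/ (exists2 p : nat, p \in [pchar K] & (n < p)%N) ->
  forall k, (0 < k <= n)%N -> k%:R != 0 :> K.
Proof.
case=> [char0|[p charp np]] k /andP[k_gt0 kn].
  by move/pcharf0P: char0 => ->; rewrite -lt0n.
by rewrite -(dvdn_pcharf charp) gtnNdvd // (leq_ltn_trans kn).
Qed.

Theorem proposition1 (n : nat) (n_ge2 : (2 <= n)%N) (K : fieldType)
    (charK : [pchar K] =i pred0 \/ exists2 p : nat, p \in [pchar K] & (n < p)%N)
    (Kbar : closedFieldType) (iota : {rmorphism K -> Kbar})
    (Kbar_closure : is_algebraic_closure iota)
    (A B : 'M[K]_n)
    (AB : A *m A - 2%:R *: (A *m B) + B *m B = 0) :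
  sim_triangularizable_over iota A B.
Proof.
pose X := (map_mx iota A)^T; pose N := X - (map_mx iota B)^T.
have XN : X *m N - N *m X = N *m N.
  have /(congr1 (fun M => (map_mx iota M)^T)) := AB.
  rewrite scaler_nat map_mxD map_mxB mulr2n map_mxD !map_mxM map_mx0 trmx0.
  rewrite linearD linearB linearD /= !trmx_mul -/X.
  set Y := (map_mx iota B)^T => XY.
  rewrite /N -/Y !mulmxBl !mulmxBr; congr (_ - _).
  apply/eqP; rewrite -subr_eq0 opprB addrACA -opprD.
  by rewrite [eqbLHS]addrAC XY.
have charKbar k : (0 < k <= n)%N -> k%:R != 0 :> Kbar.
  move=> kn; rewrite -(rmorph_nat iota) fmorph_eq0; exact: natr_neq0_pchar kn.
have [P [T [U [uP [tT tU] PX PN]]]] := commutator_sqr_cotrig charKbar XN.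
have upper (M : 'M[Kbar]_n) V : is_trig_mx V -> P *m M^T = V *m P ->
    is_upper_trig_mx (invmx P^T *m M *m P^T).
  move=> tV PM; rewrite /is_upper_trig_mx !trmx_mul trmx_inv trmxK mulmxA.
  by rewrite PM mulmxK.
exists P^T; split; first by rewrite unitmx_tr.
  exact: upper tT PX.
(* B^T = X - N becomes T - U in the basis that turns X and N into T and U. *)
apply: (upper _ (T - U)); last by rewrite mulmxBl -PX -PN -mulmxBr /N subKr.
apply/is_trig_mxP => i j ij.
by rewrite !mxE (is_trig_mxP tT) // (is_trig_mxP tU) // subrr.
Qed.
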